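(* For all integers $r\ge 1$ and $d\ge 5$ with $d\le r+2$ there is a constant $c=c(d,r)>0$ such that for every sufficiently large (depending on $d,r$) prime power $q$ there exist an integer $n$ with $(r+1)\mid n$ and $$n\ \ge\ c\, q^{\,1+\frac{1}{\lfloor (d-3)/2\rfloor}}$$ and an optimal LRC over $\mathbb{F}_q$ with locality $r$, length $n$ and minimum distance $d$. In particular, for $d=5$ and every fixed $r\ge 3$, one obtains optimal LRCs with $(r+1)\mid n$ of length at least $c(5,r)\,q^2$, and the order $q^2$ is best possible: there is a constant $C'=C'(r)$ such that every optimal LRC over $\mathbb{F}_q$ with locality $r$, minimum distance $5$ and length $n$ divisible by $r+1$ has $n\le C' q^2$.
   Context: All codes are linear. For a code $C\subseteq \mathbb{F}_q^n$, an index $i\in\{1,\dots,n\}$ and $\alpha\in\mathbb{F}_q$, let $C(i,\alpha)=\{(c_1,\dots,c_n)\in C : c_i=\alpha\}$, and for $I\subseteq\{1,\dots,n\}\setminus\{i\}$ let $C_I(i,\alpha)$ be the projection of $C(i,\alpha)$ on the coordinates in $I$. A set $R\subseteq\{1,\dots,n\}$ containing $i$ is a recovery set for $i$ if $C_{R\setminus\{i\}}(i,\alpha)\cap C_{R\setminus\{i\}}(i,\beta)=\emptyset$ for all $\alpha\ne\beta$ in $\mathbb{F}_q$. The code $C$ is a locally repairable code (LRC) with locality $r$ if every $i\in\{1,\dots,n\}$ has a recovery set of size $r+1$. Every linear LRC of length $n$, dimension $k\ge1$, minimum distance $d$ and locality $r$ satisfies the Singleton-type bound $d\le n-k-\lceil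 k/r\rceil+2$. For $d\le r+1$, such a code is called optimal if $d= n-k-\lceil k/r\rceil+2$. For $d=r+2$ and $(r+1)\mid n$ equality cannot be attained, and in that case a code is called optimal if $d=n-k-\lceil k/r\rceil+1$. *)

(* Defs.v *)
From HB Require Import structures.
From mathcomp Require Import all_boot all_order all_algebra.
From mathcomp Require Import reals exp.

Set Implicit Arguments.
Unset Strict Implicit.
Unset Printing Implicit Defensive.

Import Order.TTheory GRing.Theory Num.Theory.
Local Open Scope ring_scope.

(* A linear code of length n over F is a subspace of F^n; its dimension is
   \dim C.  Coordinates are indexed by 'I_n = {0, ..., n-1}. *)
Notation code F n := {vspace 'rV[F]_n}.

Section Codes.
Variables (F : finFieldType) (n : nat).
Implicit Types (C : code F n) (i : 'I_n) (I R : {set 'I_n}) (a b : F).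

(* C(i, a) *)
Definition slice C i a : {set 'rV[F]_n} :=
  [set c : 'rV[F]_n | (c \in C) && (c ord0 i == a)].

(* The coordinates in I are listed in increasing order by enum_val. *)
Definition proj I (c : 'rV[F]_n) : 'rV[F]_#|I| :=
  \row_(j < #|I|) c ord0 (enum_val j).

(* C_I(i, a) *)
Definition proj_slice C I i a : {set 'rV[F]_#|I|} :=
  [set proj I c | c in slice C i a].

Definition recovery_set C i R : Prop :=
  i \in R /\
  forall a b, a != b ->
    proj_slice C (R :\ i) i a :&: proj_slice C (R :\ i) i b = set0.

Definition has_locality C (r : nat) : Prop :=
  forall i, exists R, recovery_set C i R /\ #|R| = r.+1.

Definition hamming_dist (u v : 'rV[F]_n) : nat :=
  #|[set i : 'I_n | u ord0 i != v ord0 i]|.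

Definition is_min_dist C (d : nat) : Prop :=
  (exists u v, [/\ u \in C, v \in C, u != v & hamming_dist u v = d]) /\
  (forall u v, u \in C -> v \in C -> u != v -> (d <= hamming_dist u v)%N).

(* n - k - ceil(k / r) + 2, computed in int to avoid truncated subtraction. *)
Definition singleton_bound (k r : nat) : int :=
  n%:Z - k%:Z - Num.ceil (k%:Q / r%:Q) + 2.

(* Optimality is only defined for d <= r + 1, and for d = r + 2 when
   r + 1 divides n; in the latter case the bound itself is not attained and
   the optimal value is one less. *)
Definition optimal_LRC C (r d : nat) : Prop :=
  [/\ (1 <= \dim C)%N, has_locality C r, is_min_dist C d &
      ((d <= r.+1)%N /\ d%:Z = singleton_bound (\dim C) r) \/
      [/\ d = r.+2, (r.+1 %| n)%N & d%:Z = singleton_bound (\dim C) r - 1]].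

End Codes.

(* Main.v *)
Require Import Defs.
From HB Require Import structures.
From mathcomp Require Import all_boot all_order all_algebra.
From mathcomp Require Import finfield.
From mathcomp Require Import reals exp.
From mathcomp Require Import zify ring.

(* Lower bound.  Let [H] be an [r+1]-uniform hypergraph on the vertex set [F]
   without Berge cycles of length at most [g+1], where [g = (d-3)/2].  Index
   coordinates by incidences [(e, x)], [x] in [e], and impose one parity check
   per edge together with the [d-2] moment checks [sum c_(e,x) x^j = 0],
   [1 <= j <= d-2].  For a codeword of weight below [d], summing over the edges
   at each point gives a function on [F] with fewer than [d] nonzero values and
   [d-1] vanishing moments, hence zero; so every touched edge and every touched
   point is touched twice, which forces a short cycle in [H].  Edges are added
   greedily, joining points of small degree that are pairwise at distance more
   than [g], until there are of order [q^(1+1/g)] of them.  When [d = r+2] the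
   Singleton-type bound still allows distance [d+1], so the greedy process is
   started from two disjoint edges that carry a codeword of weight [d].

   Upper bound for [d = 5].  A minimal family [J] of local checks covering all
   coordinates is independent, and redundancy [N+3], [N = n/(r+1)], leaves all
   but a bounded number of checks with two private coordinates.  Each of these
   gives a vector of weight 2 satisfying every check in [J]; modulo the code
   these vectors are pairwise non-proportional in a space of dimension at most
   3, so there are at most about [q^2] of them. *)

Set Implicit Arguments.
Unset Strict Implicit.
Unset Printing Implicit Defensive.

Import Order.TTheory GRing.Theory Num.Theory.

(** * Hypergraphs of large girth *)

Section Hypergraph.
Variable V : finType.
Implicit Types (H : {set {set V}}) (S : {set {set V} * V}) (e f : {set V}).
Implicit Types (x y z : V) (g D : nat).

Definition incidences H : {set {set V} * V} :=
  [set p | (p.1 \in H) && (p.2 \in p.1)].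

Definition touched S : {set {set V}} := [set p.1 | p in S].

Definition leafless_except z S : Prop :=
  forall e x, (e, x) \in S ->
    (exists2 y, y != x & (e, y) \in S) /\
    (x != z -> exists2 f, f != e & (f, x) \in S).

(* Equivalent to the absence of Berge cycles with at most [g] edges; allowing
   one exceptional leaf [z] makes the property stable under the component
   argument of [girth_gtU1]. *)
Definition girth_gt g H : Prop :=
  forall S z, S != set0 -> S \subset incidences H -> leafless_except z S ->
    g < #|touched S|.

Definition star H x : {set {set V}} := [set e in H | x \in e].

Definition nbhd H x : {set V} := x |: \bigcup_(e in star H x) e.

Fixpoint ball H g x : {set V} :=
  if g is g'.+1 then \bigcup_(y in nbhd H x) ball H g' y else [set x].

Lemma leq_card_bigcup (I : finType) (P : {set I}) (A : I -> {set V}) b :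
  (forall i, i \in P -> #|A i| <= b) -> #|\bigcup_(i in P) A i| <= #|P| * b.
Proof.
move=> hA; rewrite -sum_nat_const.
apply: (@leq_trans (\sum_(i in P) #|A i|)); last exact: leq_sum.
elim/big_rec2: _ => [|i n B _ IH]; first by rewrite cards0.
by apply: leq_trans (leq_card_setU _ _) _; rewrite leq_add2l.
Qed.

Lemma mem_nbhd H x : x \in nbhd H x.
Proof. exact: setU11. Qed.

Lemma ball_leq H g g' x : g <= g' -> ball H g x \subset ball H g' x.
Proof.
move/subnK <-; elim: (g' - g) => //= n IH.
apply: subset_trans IH _; apply: (bigcup_sup x); exact: mem_nbhd.
Qed.

Lemma mem_ball H g x : x \in ball H g x.
Proof. by apply: (subsetP (ball_leq H x (leq0n g))); rewrite inE. Qed.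

Lemma card_ball H g x m D :
  (forall e, e \in H -> #|e| <= m) -> (forall y, #|star H y| <= D) ->
  #|ball H g x| <= (1 + D * m) ^ g.
Proof.
move=> hm hD; elim: g x => [|g IH] x /=; first by rewrite cards1.
rewrite expnS; apply: leq_trans (leq_card_bigcup (b := (1 + D * m) ^ g) _) _.
  by move=> y _.
rewrite leq_mul2r; apply/orP; right; apply: leq_trans (leq_card_setU _ _) _.
rewrite cards1 leq_add2l; apply: leq_trans (leq_card_bigcup (b := m) _) _.
  by move=> e; rewrite inE => /andP[/hm].
by rewrite leq_mul2r hD orbT.
Qed.

Definition meet_in S : rel {set V} :=
  fun e f => [exists x, ((e, x) \in S) && ((f, x) \in S)].

Lemma meet_inC S : connect_sym (meet_in S).
Proof.
by apply: sym_connect_sym => e f; apply: eq_existsb => x; rewrite andbC.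
Qed.

Lemma walk_ball H S e x s y :
  S \subset incidences H -> path (meet_in S) e s -> (e, x) \in S ->
  (last e s, y) \in S -> y \in ball H (size s).+1 x.
Proof.
move=> sSH; have step e' u v : (e', u) \in S -> (e', v) \in S -> v \in nbhd H u.
  move=> /(subsetP sSH); rewrite !inE /= => /andP[eH ue].
  move=> /(subsetP sSH); rewrite !inE /= => /andP[_ ve].
  by apply/orP; right; apply/bigcupP; exists e' => //; rewrite inE eH.
elim: s e x => [|f s IH] e x /=.
  by move=> _ hx hy; apply/bigcupP; exists y; [exact: (step e)|rewrite inE].
move=> /andP[/existsP[u /andP[heu hfu]] hs] hx hy.
by apply/bigcupP; exists u; [exact: (step e)|exact: (IH f)].
Qed.

(** A connecting path can be taken without repeated edges; its edges are all touched by [S], so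
    there are at most [g] of them. *)
Lemma connect_ball H S e f x y g :
  S \subset incidences H -> #|touched S| <= g -> (e, x) \in S ->
  (f, y) \in S -> connect (meet_in S) e f -> y \in ball H g x.
Proof.
move=> sSH hg hx hy /connectP[s0 hs0 hf]; rewrite hf in hy.
case/shortenP: hs0 hy => s hs us _ hy.
apply: (subsetP (ball_leq H x _)) (walk_ball sSH hs hx hy).
apply: leq_trans hg; rewrite -[(size s).+1]/(size (e :: s)).
rewrite -(card_uniqP us); apply/subset_leq_card/subsetP => e'.
rewrite inE => /orP[/eqP->|]; first by apply/imsetP; exists (e, x).
elim: s e hs {us hx hy hf} => //= f' s IH e /andP[/existsP[u /andP[_ hu]] hs].
rewrite inE => /orP[/eqP->|]; last exact: IH hs.
by apply/imsetP; exists (f', u).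
Qed.

(** By the girth of [H], a short leafless [S] must use [e0]. Without [e0] it touches at most [g]
    edges, so by the distance hypothesis the parts hanging from distinct points of [e0] lie in
    different components. One such component is leafless except at its point of [e0], which
    contradicts the girth of [H]. *)
Lemma girth_gtU1 H g e0 :
  girth_gt g.+1 H ->
  {in e0 &, forall x y, x != y ->
     (y \notin ball H g x) || (x \notin ball H g y)} ->
  girth_gt g.+1 (e0 |: H).
Proof.
move=> gH far S z S0 sSH core; rewrite ltnNge; apply/negP => tS.
pose S' := [set p in S | p.1 != e0].
have mS' e x : ((e, x) \in S') = ((e, x) \in S) && (e != e0) by rewrite inE.
have sS'H : S' \subset incidences H.
  apply/subsetP => -[e x]; rewrite mS' => /andP[/(subsetP sSH)].
  by rewrite !inE /= => /andP[/orP[->|->]].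
have [/imsetP[[e x0] hx0 /= e0E]|he0] := boolP (e0 \in touched S); last first.
  have SS' : S' = S.
    apply/setP => -[e x]; rewrite mS'; case: (boolP (_ \in S)) => //= hS.
    by apply/eqP => eE; case/negP: he0; apply/imsetP; exists (e, x).
  by rewrite SS' in sS'H; have := gH S z S0 sS'H core; rewrite ltnNge tS.
rewrite -{e}e0E in hx0.
have tS' : #|touched S'| <= g.
  rewrite -ltnS; apply: leq_trans tS; apply: proper_card; apply/properP; split.
    by apply: imsetS; apply/subsetP => p; rewrite inE => /andP[].
  exists e0; first by apply/imsetP; exists (e0, x0).
  by apply/imsetP => -[[e x] /= + eE]; rewrite mS' -eE eqxx andbF.
have far' e f x y : (e0, x) \in S -> (e0, y) \in S -> x != y ->
    (e, x) \in S' -> (f, y) \in S' -> ~~ connect (meet_in S') e f.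
  have in0 u : (e0, u) \in S -> u \in e0 by move/(subsetP sSH); rewrite inE /= => /andP[].
  move=> /in0 hx /in0 hy xy hex hfy; apply/negP => hc.
  have := far x y hx hy xy; rewrite (connect_ball sS'H tS' hex hfy hc) /=.
  by rewrite (connect_ball sS'H tS' hfy hex) // meet_inC.
have meet_trans a e f u : (e, u) \in S' -> (f, u) \in S' ->
    connect (meet_in S') a e -> connect (meet_in S') a f.
  move=> he hf hc; apply: connect_trans hc (connect1 _).
  by apply/existsP; exists u; rewrite he hf.
pose T x := [set p in S' | [exists e, ((e, x) \in S') && connect (meet_in S') e p.1]].
(* [S] touches [e0] at two points [x0] and [y0]. The exceptional point [z] is equal or connected to
   at most one of them, and the other one is chosen. *)
have [x [hx xz zT]] : exists x, [/\ (e0, x) \in S, x != z & forall f, (f, z) \notin T x].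
  have zT a b f : (e0, a) \in S -> a != z -> (e0, b) \in S -> b != a -> (f, z) \in T a ->
      forall f', (f', z) \notin T b.
    move=> ha az hb ba; rewrite inE => /andP[hf /existsP[e /andP[he hc]]] f'.
    rewrite inE; apply/negP => /andP[hf' /existsP[e' /andP[he' hc']]].
    have := far' _ _ _ _ hb ha ba he' he; rewrite (meet_inC S').
    rewrite /= in hc hc'; case/negP; apply: connect_trans (meet_trans _ _ _ _ hf hf' hc) _.
    by rewrite meet_inC.
  have zTz a b f : (e0, a) \in S -> a = z -> (e0, b) \in S -> b != a -> (f, z) \notin T b.
    move=> ha az hb ba; rewrite inE /= -az; apply/negP => /andP[hf /existsP[e /andP[he]]].
    by apply/negP; apply: (far' _ _ b a).
  have [[y0 yx0 hy0] _] := core _ _ hx0.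
  have [x0z|x0z] := eqVneq x0 z.
    exists y0; split=> //; first by rewrite -x0z.
    by move=> f; apply: (zTz x0).
  have [/existsP[f hf]|] := boolP [exists f, (f, z) \in T x0]; last first.
    by rewrite negb_exists => /forallP hf; exists x0.
  have y0z : y0 != z.
    by apply: contraTneq hf => y0z; apply: (zTz y0) => //; rewrite eq_sym.
  by exists y0; split=> //; apply: (zT x0 y0 f).
have TS' : T x \subset S' by apply/subsetP => p; rewrite inE => /andP[].
have T0 : T x != set0.
  have [_ /(_ xz)[f fe0 hf]] := core _ _ hx.
  apply/set0Pn; exists (f, x); rewrite inE mS' hf fe0 /=; apply/existsP.
  by exists f; rewrite mS' hf fe0 connect0.
(* [e0] meets this component only at [x], so no other point loses its second edge; [x] becomes the
   new exceptional leaf. *)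
have coreT : leafless_except x (T x).
  move=> e u heu; have := heu; rewrite inE => /andP[heu' /existsP[a /andP[ha hc]]].
  have := heu'; rewrite mS' => /andP[heuS ee0]; have [[y yu hy] huz] := core _ _ heuS.
  split=> [|ux].
    exists y => //; rewrite inE mS' hy ee0 /=; apply/existsP; exists a.
    by rewrite ha.
  have [|f fe hf] := huz; first by apply: contraTneq heu => ->; apply: zT.
  exists f => //; have fe0 : f != e0.
    apply/eqP => fE; rewrite fE in hf.
    by have := far' _ _ _ _ hx hf _ ha heu'; rewrite eq_sym => /(_ ux)/negP; apply.
  rewrite inE mS' hf fe0 /=; apply/existsP; exists a; rewrite ha.
  by apply: meet_trans hc; [exact: heu'|rewrite mS' hf].
have := gH (T x) x T0 (subset_trans TS' sS'H) coreT.
rewrite ltnNge; case/negP; apply: leq_trans _ (leqW tS').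
exact/subset_leq_card/imsetS.
Qed.

Lemma leafless_card S z :
  leafless_except z S -> 2 * #|touched S| <= #|S|.
Proof.
move=> core; rewrite -[leqRHS]sum1_card (partition_big fst (mem (touched S))) /=.
  rewrite mulnC -sum_nat_const; apply: leq_sum => e /imsetP[[e' x] hx /= eE].
  rewrite -{e'}eE in hx.
  have [[y yx hy] _] := core _ _ hx.
  rewrite sum1_card; apply/card_gt1P; exists (e, x), (e, y).
  have mem u : (e, u) \in S -> (e, u) \in (fun p => (p \in S) && (p.1 == e)).
    by move=> hu; apply/andP; rewrite /= eqxx.
  by split; [exact: mem|exact: mem|rewrite xpair_eqE eqxx eq_sym].
by move=> p pS; apply/imsetP; exists p.
Qed.

(** * Greedy construction of sparse hypergraphs *)

(** Greedy choice: [m] chosen points exclude at most [m * b] points of [U]. The conclusion is a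
    disjunction because [B] need not be symmetric. *)
Lemma scattered_subset (U : {set V}) (B : V -> {set V}) b m :
  0 < b -> (forall x, x \in B x) -> (forall x, #|B x| <= b) -> m * b <= #|U| ->
  exists A : {set V}, [/\ A \subset U, #|A| = m &
    {in A &, forall x y, x != y -> (y \notin B x) || (x \notin B y)}].
Proof.
move=> b0 Bx Bb; elim: m => [|m IH] hU.
  by exists set0; split; rewrite ?sub0set ?cards0 // => x y; rewrite inE.
have [|A [AU cA farA]] := IH; first by apply: leq_trans hU; rewrite leq_mul2r leqnSn orbT.
have [y yU hy] : exists2 y, y \in U & y \notin \bigcup_(x in A) B x.
  apply/subsetPn; apply/negP => /subset_leq_card; rewrite leqNgt => /negP; apply.
  apply: leq_ltn_trans (leq_card_bigcup (b := b) _) _; first by move=> x _.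
  by rewrite cA; apply: leq_trans hU; rewrite ltn_mul2r b0 leqnn.
have yA : y \notin A by apply: contra hy => yA; apply/bigcupP; exists y.
exists (y |: A); split.
- by rewrite subUset sub1set yU.
- by rewrite cardsU1 yA cA.
move=> u v; rewrite !inE => /orP[/eqP->|uA] /orP[/eqP->|vA] uv; last exact: farA.
- by rewrite eqxx in uv.
- by rewrite orbC; apply/orP; left; apply: contra hy => ?; apply/bigcupP; exists v.
- by apply/orP; left; apply: contra hy => ?; apply/bigcupP; exists u.
Qed.


Lemma sum_star H : \sum_x #|star H x| = \sum_(e in H) #|e|.
Proof.
under eq_bigr => x _ do rewrite -sum1_card.
under [RHS]eq_bigr => e _ do rewrite -sum1_card.
rewrite (exchange_big_dep (mem H)) /=; last by move=> x e _; rewrite inE => /andP[].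
by apply: eq_bigr => e eH; apply: eq_bigl => x; rewrite inE eH.
Qed.

(** The cap [D] keeps balls small for the greedy step and sets the number of edges finally
    reached. *)
Record sparse_hypergraph (g r D : nat) H : Prop := SparseHypergraph {
  sparse_girth : girth_gt g.+1 H;
  sparse_uniform : forall e, e \in H -> #|e| = r.+1;
  sparse_degree : forall x, #|star H x| <= D }.

(** Counting incidences, fewer than half of the points have reached degree [D]. The remaining ones
    are numerous enough to contain [r.+1] pairwise distant points, which form the new edge. *)
Lemma sparse_extend g r D H :
  0 < g -> 0 < r -> sparse_hypergraph g r D H ->
  2 * (#|H| * r.+1) < D * #|V| -> 2 * (r.+1 * (1 + D * r.+1) ^ g) <= #|V| ->
  exists2 e, e \notin H & sparse_hypergraph g r D (e |: H).
Proof.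
move=> g0 r0 [gH uH dH] small large.
pose U := [set x | #|star H x| < D].
have cU : r.+1 * (1 + D * r.+1) ^ g <= #|U|.
  have full : D * #|~: U| <= #|H| * r.+1.
    rewrite -sum_nat_const (eq_bigr (fun e : {set V} => #|e|)); last first.
      by move=> e /uH ->.
    rewrite -sum_star (bigID (mem (~: U))) /= mulnC -sum_nat_const.
    apply: leq_trans (leq_addr _ _); apply: leq_sum => x.
    by rewrite !inE -leqNgt.
  have := cardsC U; nia.
have [||||A [AU cA farA]] := @scattered_subset U (ball H g) ((1 + D * r.+1) ^ g) r.+1.
- by rewrite expn_gt0.
- by move=> x; apply: mem_ball.
- by move=> x; apply: card_ball => // e /uH ->.
- exact: cU.
(* Points of one edge lie in each other's ball of radius [g >= 1], so a scattered set is not yet an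
   edge. *)
have AH : A \notin H.
  apply/negP => AH.
  have /card_gt1P[x [y [xA yA xy]]] : 1 < #|A| by rewrite cA.
  have near u v : u \in A -> v \in A -> v \in ball H g u.
    move=> uA vA; apply: (subsetP (ball_leq H u g0)).
    apply/bigcupP; exists v; last by rewrite inE.
    rewrite !inE; apply/orP; right; apply/bigcupP; exists A => //.
    by rewrite inE AH.
  by have := farA _ _ xA yA xy; rewrite !near.
exists A => //; split.
- exact: girth_gtU1.
- by move=> e; rewrite !inE => /orP[/eqP->//|/uH].
move=> x; have [xA|xA] := boolP (x \in A).
  have xU : #|star H x| < D by have := subsetP AU x xA; rewrite inE.
  apply: leq_trans xU; rewrite -add1n -(cards1 A).
  apply: leq_trans (leq_card_setU _ _); apply/subset_leq_card/subsetP => e.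
  by rewrite !inE => /andP[/orP[->//|->] ->]; rewrite orbT.
apply: leq_trans (dH x); apply/subset_leq_card/subsetP => e.
rewrite !inE => /andP[/orP[/eqP->|->//] xe]; by rewrite xe in xA.
Qed.

Lemma sparse_hypergraph_exists g r D H0 :
  0 < g -> 0 < r -> sparse_hypergraph g r D H0 ->
  2 * (r.+1 * (1 + D * r.+1) ^ g) <= #|V| ->
  exists H, [/\ H0 \subset H, sparse_hypergraph g r D H &
    D * #|V| <= 2 * (#|H| * r.+1)].
Proof.
move=> g0 r0 sH0 large.
(* The index [m] counts greedy steps; at [m = D * #|V|] both alternatives give the bound. *)
suff /(_ (D * #|V|))[H [HH sH []]] : forall m, exists H, [/\ H0 \subset H,
    sparse_hypergraph g r D H & m <= #|H| \/ D * #|V| <= 2 * (#|H| * r.+1)].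
- by move=> hm; exists H; split => //; nia.
- by move=> hm; exists H.
elim=> [|m [H [HH sH [mH|?]]]]; last 2 first.
- have [?|lt] := leqP (D * #|V|) (2 * (#|H| * r.+1)); first by exists H; split=> //; right.
  have [e eH sH'] := sparse_extend g0 r0 sH lt large.
  exists (e |: H); split=> //; first by apply: subset_trans HH (subsetUr _ _).
  by left; rewrite cardsU1 eH.
- by exists H; split=> //; right.
by exists H0; split=> //; left.
Qed.

(** Supplies the starting hypergraphs. When edges are disjoint no point has a second edge, so every
    touched point would be the exceptional one, yet a touched edge has two touched points. *)
Lemma sparse_disjoint g r D H :
  0 < D -> (forall e, e \in H -> #|e| = r.+1) ->
  {in H &, forall e f, e != f -> [disjoint e & f]} -> sparse_hypergraph g r D H.
Proof.
move=> D0 uH djH; have inj e f x : e \in H -> f \in H -> x \in e -> x \in f -> f = e.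
  move=> eH fH xe xf; apply: contraTeq xf => fe.
  by rewrite (disjointFr (djH e f eH fH _)) // eq_sym.
split=> // [S z /set0Pn[[e x] hx] sSH core|x].
  exfalso; have inH f y : (f, y) \in S -> f \in H /\ y \in f.
    by move/(subsetP sSH); rewrite inE => /andP[].
  have nz y : (e, y) \in S -> y == z.
    move=> hy; have [_ h] := core _ _ hy; case: (eqVneq y z) h => //= _ /(_ isT)[f fe hf].
    have [[eH ye] [fH yf]] := (inH _ _ hy, inH _ _ hf).
    by rewrite (inj _ _ _ eH fH ye yf) eqxx in fe.
  have [[y yx hy] _] := core _ _ hx.
  by move: yx; rewrite (eqP (nz _ hx)) (eqP (nz _ hy)) eqxx.
apply: leq_trans D0; apply/card_le1_eqP => e f; rewrite !inE.
by move=> /andP[eH xe] /andP[fH xf]; exact: (inj _ _ x).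
Qed.

End Hypergraph.

(** * Codes from sparse hypergraphs *)

Local Open Scope ring_scope.

(** * Functions on a field with vanishing moments *)

Lemma moments_horner (F : finFieldType) (L : F -> F) t (p : {poly F}) :
  (forall j, (j < t)%N -> \sum_x L x * x ^+ j = 0) -> (size p <= t)%N ->
  \sum_x L x * p.[x] = 0.
Proof.
move=> mom pt; under eq_bigr => x _ do rewrite (horner_coef_wide x pt) mulr_sumr.
rewrite exchange_big big1 //= => j _.
under eq_bigr => x _ do rewrite mulrCA.
by rewrite -mulr_sumr mom ?mulr0.
Qed.

Lemma moments_eq0 (F : finFieldType) (L : F -> F) t :
  (forall j, (j < t)%N -> \sum_x L x * x ^+ j = 0) ->
  (#|[set x | L x != 0%R]| <= t)%N -> forall x, L x = 0.
Proof.
move=> mom cL a; apply/eqP; apply: contraT => La.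
pose s := [set x | L x != 0] :\ a; pose p := \prod_(x <- enum s) ('X - x%:P).
have pt : (size p <= t)%N.
  by rewrite size_prod_XsubC -cardE (leq_trans _ cL) // [leqRHS](cardsD1 a) inE La.
have := moments_horner mom pt; rewrite (bigD1 a) //= big1 ?addr0 => [/eqP|x xa].
  rewrite mulf_eq0 (negPf La) horner_prod prodf_seq_eq0 /=.
  by case/hasP => x; rewrite mem_enum !inE hornerXsubC subr_eq0 eq_sym => /andP[/negPf->].
have [->|Lx] := eqVneq (L x) 0; first by rewrite mul0r.
apply/eqP; rewrite mulf_eq0 horner_prod prodf_seq_eq0; apply/orP; right.
apply/hasP; exists x; first by rewrite mem_enum !inE Lx xa.
by rewrite /= hornerXsubC subrr.
Qed.

Lemma moments_exist (F : finFieldType) (A : {set F}) t : (t < #|A|)%N ->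
  exists L : F -> F, [/\ forall x, x \notin A -> L x = 0, exists x, L x != 0 &
    forall j, (j < t)%N -> \sum_x L x * x ^+ j = 0].
Proof.
move=> tA; pose M : 'M[F]_(#|A|, t) := \matrix_(i, j) enum_val i ^+ j.
have : kermx M != 0.
  by rewrite kermx_eq0 -row_leq_rank -ltnNge (leq_ltn_trans (rank_leq_col M)).
case/rowV0Pn => v /sub_kermxP vM v0.
pose L x := \sum_(i < #|A|) v ord0 i *+ (enum_val i == x).
exists L; split.
- move=> x xA; rewrite /L big1 // => i _; case: eqP => // ix.
  by case/negP: xA; rewrite -ix enum_valP.
- have [i vi] : exists i, v ord0 i != 0.
    by apply/existsP; apply: contraNT v0 => /existsPn v0; apply/eqP/rowP => i;
       rewrite mxE; apply/eqP/negPn/v0.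
  exists (enum_val i); rewrite /L (bigD1 i) //= eqxx big1 ?addr0 // => j ji.
  by rewrite (inj_eq enum_val_inj) (negPf ji).
move=> j jt; have := congr1 (fun w : 'rV_t => w ord0 (Ordinal jt)) vM.
rewrite !mxE => h; apply: etrans h; rewrite /L.
under eq_bigr => x _ do rewrite mulr_suml.
rewrite exchange_big /=; apply: eq_bigr => i _; rewrite mxE /=.
rewrite (bigD1 (enum_val i)) //= eqxx big1 ?addr0 ?mulr1n // => x.
by rewrite eq_sym => /negPf->; rewrite mul0r.
Qed.

Definition supp (F : finFieldType) n (c : 'rV[F]_n) : {set 'I_n} :=
  [set i | c ord0 i != 0].

Lemma is_min_dist_linear (F : finFieldType) n (C : code F n) d :
  (exists c, [/\ c \in C, c != 0 & (#|supp c| <= d)%N]) ->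
  (forall c, c \in C -> c != 0 -> (d <= #|supp c|)%N) -> is_min_dist C d.
Proof.
have distE (u v : 'rV[F]_n) : hamming_dist u v = #|supp (u - v)|.
  by apply: eq_card => i; rewrite !inE !mxE subr_eq0.
move=> [c [cC c0 cd]] lb; split.
  exists c, 0; rewrite mem0v distE subr0; split=> //.
  by apply/eqP; rewrite eqn_leq cd lb.
by move=> u v uC vC uv; rewrite distE lb ?memvB // subr_eq0.
Qed.

Section SparseCode.
Variables (F : finFieldType) (H : {set {set F}}) (t : nat).
Local Notation X := (incidences H).

(** The exponents start at 1: the moment of exponent 0 is the sum of the edge checks, so listing it
    would make the columns dependent. *)
Definition parity_mx : 'M[F]_(#|X|, #|H| + t) :=
  row_mx (\matrix_(i, j) ((enum_val i).1 == enum_val j)%:R)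
         (\matrix_(i, j) (enum_val i).2 ^+ j.+1).

Definition sparse_code : code F #|X| := lker (linfun (mulmxr parity_mx)).

Lemma sparse_codeP (c : 'rV[F]_#|X|) :
  reflect ((forall e, e \in H -> \sum_i c ord0 i * ((enum_val i).1 == e)%:R = 0) /\
           (forall j, (j < t)%N -> \sum_i c ord0 i * (enum_val i).2 ^+ j.+1 = 0))
          (c \in sparse_code).
Proof.
rewrite memv_ker lfunE /= mul_mx_row.
apply: (iffP eqP) => [|[hb hm]].
  rewrite -row_mx0 => /eq_row_mx[hb hm]; split=> [e eH|j jt].
    have := congr1 (fun w : 'rV_#|H| => w ord0 (enum_rank_in eH e)) hb.
    rewrite !mxE => h; apply: etrans h; apply: eq_bigr => i _.
    by rewrite mxE enum_rankK_in.
  have := congr1 (fun w : 'rV_t => w ord0 (Ordinal jt)) hm.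
  by rewrite !mxE => h; apply: etrans h; apply: eq_bigr => i _; rewrite mxE.
rewrite -row_mx0; congr row_mx; apply/rowP => j; rewrite !mxE.
  apply: etrans (hb (enum_val j) (enum_valP j)).
  by apply: eq_bigr => i _; rewrite mxE.
by apply: etrans (hm j (ltn_ord j)); apply: eq_bigr => i _; rewrite mxE.
Qed.

Lemma enum_val_incidence (i : 'I_#|X|) :
  (enum_val i).1 \in H /\ (enum_val i).2 \in (enum_val i).1.
Proof. by have := enum_valP i; rewrite inE => /andP[]. Qed.

Lemma incidence_rank e x : e \in H -> x \in e -> exists i : 'I_#|X|, enum_val i = (e, x).
Proof.
move=> eH xe; have ex : (e, x) \in X by rewrite inE eH.
by exists (enum_rank_in ex (e, x)); rewrite enum_rankK_in.
Qed.

Variable r : nat.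
Hypothesis uH : forall e, e \in H -> #|e| = r.+1.

Lemma card_incidences : #|X| = (#|H| * r.+1)%N.
Proof.
rewrite -sum1_card (partition_big fst (mem H)) /=; last first.
  by move=> p; rewrite inE => /andP[].
rewrite -sum_nat_const; apply: eq_bigr => e eH.
rewrite -(uH eH) -sum1_card (reindex_onto (fun x => (e, x)) snd) /=.
  by apply: eq_bigl => x; rewrite inE /= eH !eqxx !andbT.
by move=> [f x] /= /andP[_ /eqP->].
Qed.

Lemma sparse_code_locality : has_locality sparse_code r.
Proof.
move=> i; have [eH xe] := enum_val_incidence i; set e := (enum_val i).1 in eH xe.
exists [set i' : 'I_#|X| | (enum_val i').1 == e]; split; last first.
  rewrite -(uH eH) -(card_in_imset (f := fun i' : 'I_#|X| => (enum_val i').2)).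
    apply: eq_card => x; apply/imsetP/idP => [[i' + ->]|{}xe].
      by rewrite inE => /eqP <-; have [] := enum_val_incidence i'.
    by have [i' i'E] := incidence_rank eH xe; exists i'; rewrite ?inE i'E /=.
  move=> i1 i2; rewrite !inE => /eqP h1 /eqP h2 h.
  by apply: enum_val_inj; apply: injective_projections; rewrite ?h1.
split; first by rewrite inE eqxx.
move=> a b ab; apply/setP => w; rewrite in_set0; apply/negP; rewrite inE.
case/andP => /imsetP[u + ->] /imsetP[v].
rewrite !inE => /andP[uC /eqP ua] /andP[vC /eqP vb] /rowP uv.
have /sparse_codeP[/(_ e eH) + _] := memvB uC vC.
rewrite (bigD1 i) //= eqxx mulr1 big1 ?addr0 => [|j ji].
  by rewrite !mxE ua vb => /eqP; rewrite subr_eq0 (negPf ab).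
have [je|_] := eqVneq (enum_val j).1 e; last by rewrite mulr0.
have jR : j \in [set i' : 'I_#|X| | (enum_val i').1 == e] :\ i by rewrite !inE ji je /=.
have := uv (enum_rank_in jR j); rewrite !mxE enum_rankK_in // => ->.
by rewrite subrr mul0r.
Qed.

(** The checks are independent: a linear relation says that, for each edge, the polynomial with
    constant term [a_j] and higher coefficients [b] vanishes at the [r+1] points of the edge, while
    its degree is at most [t <= r]. *)
Lemma dim_sparse_code : (t <= r)%N -> H != set0 ->
  (\dim sparse_code + (#|H| + t) = #|X|)%N.
Proof.
move=> tr /set0Pn[e0 e0H].
have free : row_free parity_mx^T.
  apply: inj_row_free => v; rewrite -[v]hsubmxK.
  move: (lsubmx v) (rsubmx v) => a b.
  rewrite tr_row_mx mul_row_col => /rowP hv.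
  have zero j : cons_poly (a ord0 j) (rVpoly b) = 0.
    have eH := enum_valP j; apply: (@roots_geq_poly_eq0 _ _ (enum (enum_val j))).
    - apply/allP => x; rewrite mem_enum => xe.
      have [i iE] := incidence_rank eH xe.
      rewrite rootE horner_cons addrC; apply/eqP; have := hv i; rewrite !mxE => <-.
      congr (_ + _).
        rewrite (bigD1 j) //= !mxE iE eqxx mulr1 big1 ?addr0 // => j' j'j.
        by rewrite !mxE iE /= (inj_eq enum_val_inj) eq_sym (negPf j'j) mulr0.
      have tb : (size (rVpoly b) <= t)%N by exact: size_poly.
      rewrite (horner_coef_wide x tb) mulr_suml; apply: eq_bigr => k _.
      by rewrite !mxE iE coef_rVpoly_ord exprSr mulrA.
    - exact: enum_uniq.
    rewrite size_cons_poly -cardE (uH eH); case: ifP => // _.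
    by rewrite ltnS (leq_trans _ tr) //; apply: size_poly.
  have a0 : a = 0.
    apply/rowP => j; have /(congr1 (fun p : {poly F} => p`_0)) := zero j.
    by rewrite coef_cons coef0 /= => ->; rewrite mxE.
  suff -> : b = 0 by rewrite a0 row_mx0.
  rewrite -[b]rVpolyK; suff -> : rVpoly b = 0 by rewrite linear0.
  apply/polyP => k; have := zero (enum_rank_in e0H e0).
  by move/(congr1 (fun p : {poly F} => p`_k.+1)); rewrite coef_cons !coef0.
have full : row_full parity_mx by rewrite /row_full -mxrank_tr.
set f : 'Hom('rV_#|X|, 'rV_(#|H| + t)) := linfun (mulmxr parity_mx).
have limf : limg f = fullv.
  apply/eqP; rewrite eqEsubv subvf; apply/subvP => w _.
  have [B BM] := row_fullP full.
  apply/memv_imgP; exists (w *m B); first exact: memvf.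
  by rewrite lfunE /= -mulmxA BM mulmx1.
have := limg_ker_dim f fullv.
by rewrite limf capfv !dimvf !dim_matrix !mul1r.
Qed.

(** The support of a word of weight at most [t+1] would be leafless, so it would touch at least
    [g+2] edges, each of them twice; but [2 (g+2) >= t+2]. *)
Lemma sparse_code_weight g c : girth_gt g.+1 H -> (t + 2 <= 2 * g + 4)%N ->
  c \in sparse_code -> c != 0 -> (t + 2 <= #|supp c|)%N.
Proof.
move=> gH tg /sparse_codeP[hb hm] c0; rewrite leqNgt addn2 ltnS; apply/negP => cs.
pose L x := \sum_(i | (enum_val i).2 == x) c ord0 i.
have momL j : \sum_x L x * x ^+ j = \sum_i c ord0 i * (enum_val i).2 ^+ j.
  rewrite [RHS](partition_big (fun i => (enum_val i).2) predT) //=.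
  by apply: eq_bigr => x _; rewrite mulr_suml; apply: eq_bigr => i /eqP <-.
(* Moments 0 to [t] of [L] vanish, the one of exponent 0 as the sum of the edge checks, and [L] has
   at most [t+1] nonzero values. *)
have L0 x : L x = 0.
  apply: (@moments_eq0 _ _ t.+1) => [[|j] jt|].
  - rewrite momL; under eq_bigr => i _ do rewrite expr0 mulr1.
    rewrite (partition_big (fun i => (enum_val i).1) (mem H)) /=; last first.
      by move=> i _; have [] := enum_val_incidence i.
    rewrite big1 // => e eH; rewrite -[RHS](hb e eH) big_mkcond /=.
    by apply: eq_bigr => i _; case: eqP; rewrite ?mulr1 ?mulr0.
  - by rewrite momL hm.
  apply: leq_trans cs; apply: leq_trans (leq_imset_card (fun i => (enum_val i).2) _).
  apply/subset_leq_card/subsetP => y; rewrite inE => Ly; apply/imsetP.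
  have [i /andP[/eqP iy ci]] : exists i, ((enum_val i).2 == y) && (c ord0 i != 0).
    apply/existsP; apply: contraNT Ly => /existsPn Ly; rewrite /L big1 // => i iy.
    by have := Ly i; rewrite iy /= negbK => /eqP.
  by exists i; rewrite ?inE.
have other (p : pred 'I_#|X|) i : p i -> \sum_(j | p j) c ord0 j = 0 -> c ord0 i != 0 ->
    exists j, [/\ p j, j != i & c ord0 j != 0].
  move=> pi sum0 ci; have
    [j /and3P[pj ji cj]|none] := pickP (fun j => [&& p j, j != i & c ord0 j != 0]).
    by exists j.
  case/eqP: ci; rewrite -[RHS]sum0 (bigD1 i) //= big1 ?addr0 // => j /andP[pj ji].
  by have := none j; rewrite pj ji /= => /negbFE/eqP.
pose S := [set enum_val i | i in supp c].
(* There is no leaf at all, so the exceptional point [0] is an arbitrary choice. *)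
have core : leafless_except 0 S.
  move=> e x /imsetP[i + ei]; rewrite inE => ci; split=> [|_].
    have [||j [/eqP je ji cj]] := other (fun j => (enum_val j).1 == e) i _ _ ci.
    - by rewrite -ei.
    - have [eH _] := enum_val_incidence i; rewrite -ei /= in eH.
      rewrite -[RHS](hb e eH) big_mkcond /=.
      by apply: eq_bigr => j _; case: eqP; rewrite ?mulr1 ?mulr0.
    exists (enum_val j).2.
      apply: contra ji => /eqP jx; apply/eqP/enum_val_inj.
      by rewrite -ei -je -jx -surjective_pairing.
    by apply/imsetP; exists j; rewrite ?inE // -je -surjective_pairing.
  have [||j [/eqP jx ji cj]] := other (fun j => (enum_val j).2 == x) i _ _ ci.
  - by rewrite -ei.
  - exact: L0.
  exists (enum_val j).1.
    apply: contra ji => /eqP je; apply/eqP/enum_val_inj.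
    by rewrite -ei -je -jx -surjective_pairing.
  by apply/imsetP; exists j; rewrite ?inE // -jx -surjective_pairing.
have S0 : S != set0.
  apply/set0Pn; have [i ci] : exists i, c ord0 i != 0.
    apply/existsP; apply: contraNT c0 => /existsPn c0; apply/eqP/rowP => i.
    by rewrite mxE; apply/eqP/negPn/c0.
  by exists (enum_val i); apply/imsetP; exists i; rewrite ?inE.
have SX : S \subset X by apply/subsetP => _ /imsetP[i _ ->]; apply: enum_valP.
have := gH S 0 S0 SX core; have := leafless_card core.
rewrite [#|S|]card_imset; last exact: enum_val_inj.
move=> le2 lt1; suff : (2 * g.+2 <= t.+1)%N by lia.
by apply: leq_trans cs; apply: leq_trans le2; rewrite leq_mul2l.
Qed.

(** Lifts a function on points to a codeword by placing [L x] on the single incidence [(s x, x)].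
    This preserves moments and weight, and the last hypothesis is the edge checks. *)
Lemma sparse_code_word (D : {set F}) (L : F -> F) (s : F -> {set F}) :
  #|D| = (t + 2)%N -> (forall x, x \notin D -> L x = 0) -> (exists x, L x != 0) ->
  (forall j, (j < t.+1)%N -> \sum_x L x * x ^+ j = 0) ->
  (forall x, x \in D -> s x \in H /\ x \in s x) ->
  (forall e, e \in H -> \sum_(x in D | s x == e) L x = 0) ->
  exists c, [/\ c \in sparse_code, c != 0 & (#|supp c| <= t + 2)%N].
Proof.
move=> cD LD [a La] mom hs hL.
pose w (p : {set F} * F) := if (p.2 \in D) && (s p.2 == p.1) then L p.2 else 0.
pose c : 'rV[F]_#|X| := \row_i w (enum_val i).
have sumc (G : {set F} * F -> F) :
    \sum_i c ord0 i * G (enum_val i) = \sum_(x in D) L x * G (s x, x).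
  under eq_bigr => i _ do rewrite mxE.
  rewrite -(big_enum_val (fun p => w p * G p)).
  rewrite (bigID (fun p => (p.2 \in D) && (s p.2 == p.1))) /=.
  rewrite [X in _ + X]big1 ?addr0 => [|p /andP[_ /negPf hp]]; last first.
    by rewrite /w hp mul0r.
  rewrite (reindex_onto (fun x => (s x, x)) snd) /=; last first.
    by move=> [e x] /= /andP[_ /andP[_ /eqP->]].
  apply: eq_big => [x|x /andP[/andP[_ hx] _]]; last by rewrite /w /= hx.
  rewrite !eqxx !andbT; case: (boolP (x \in D)) => [/hs[hx1 hx2]|]; last by rewrite andbF.
  by rewrite inE /= hx1 hx2.
have aD : a \in D by apply: contraNT La => /LD ->.
exists c; split.
- apply/sparse_codeP; split=> [e eH|j jt].
    rewrite (sumc (fun p => (p.1 == e)%:R)) -[RHS](hL e eH) [RHS]big_mkcondr /=.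
    by apply: eq_bigr => x _; case: eqP; rewrite ?mulr1 ?mulr0.
  rewrite (sumc (fun p => p.2 ^+ j.+1)) -[RHS](mom j.+1 jt) [RHS](bigID (mem D)) /=.
  by rewrite [X in _ = _ + X]big1 ?addr0 // => x /LD ->; rewrite mul0r.
- have [h1 h2] := hs a aD; have [i iE] := incidence_rank h1 h2.
  apply: contraNneq La => c0; have := congr1 (fun v : 'rV_#|X| => v ord0 i) c0.
  by rewrite [LHS]mxE iE /w /= aD eqxx /= => ->; rewrite mxE.
rewrite -cD -(card_in_imset (f := fun i : 'I_#|X| => (enum_val i).2)) => [|i j].
  apply/subset_leq_card/subsetP => _ /imsetP[i + ->].
  by rewrite inE mxE /w; case: (_ \in D) => //=; rewrite eqxx.
rewrite !inE !mxE /w; case: ifP => [/andP[_ /eqP h1] _|_]; last by rewrite eqxx.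
case: ifP => [/andP[_ /eqP h2] _|_]; last by rewrite eqxx.
by move=> h; apply/enum_val_inj/injective_projections; rewrite // -h1 -h2 h.
Qed.

End SparseCode.

Lemma ceil_div_eq (k r m : nat) : (0 < r)%N -> (k <= r * m < k + r)%N ->
  Num.ceil (k%:Q / r%:Q) = m.
Proof.
move=> r0 /andP[h1 h2]; have r0' : 0 < r%:Q by rewrite ltr0n.
apply: ceil_def; rewrite ltr_pdivlMr // ler_pdivrMr //.
rewrite -!pmulrn -!natrM intrD -[m%:~R]pmulrn.
rewrite mulrDl -natrM mulN1r ltrBlDr -natrD ltr_nat ler_nat; lia.
Qed.

(** Here [n = (r+1) #|H|] and [k = r #|H| - (d-2)]. The ceiling of [k/r] is [#|H|] when [d <= r+1]
    and [#|H| - 1] when [d = r+2]; the latter is why the bound then exceeds [d] by one. *)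
Lemma sparse_code_optimal (F : finFieldType) (H : {set {set F}}) g r D d :
  sparse_hypergraph g r D H -> (2 <= d <= 2 * g + 4)%N -> (2 < d <= r + 2)%N ->
  (d - 2 < r * #|H|)%N ->
  (exists c, [/\ c \in sparse_code H (d - 2), c != 0 & (#|supp c| <= d)%N]) ->
  optimal_LRC (sparse_code H (d - 2)) r d.
Proof.
move=> [gH uH _] dg dr dH word.
have r0 : (0 < r)%N by lia.
have H0 : H != set0 by rewrite -card_gt0; lia.
have dr2 : (d - 2 <= r)%N by lia.
have dimC := dim_sparse_code uH dr2 H0.
have nE := card_incidences uH.
set C := sparse_code _ _ in dimC word *.
have kE : (\dim C + (d - 2) = r * #|H|)%N by lia.
split; [lia|exact: sparse_code_locality uH| |].
  apply: is_min_dist_linear => // c cC c0.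
  by have := sparse_code_weight gH _ cC c0; lia.
have [d1|d1] := leqP d r.+1.
  left; split=> //; rewrite /singleton_bound (@ceil_div_eq _ _ #|H|) //; lia.
right; have dE : d = r.+2 by lia.
split=> //; first by rewrite (card_incidences uH) dvdn_mull.
rewrite /singleton_bound (@ceil_div_eq _ _ (#|H|.-1)) //; nia.
Qed.

(** * Long optimal codes *)

Lemma subset_of_card (V : finType) (U : {set V}) m : (m <= #|U|)%N ->
  exists2 A : {set V}, A \subset U & #|A| = m.
Proof.
move=> mU; have [||||A [AU cA _]] := @scattered_subset V U (fun x => [set x]) 1 m.
- by [].
- by move=> x; rewrite inE.
- by move=> x; rewrite cards1.
- by rewrite muln1.
by exists A.
Qed.

(** * Words of weight [d] in one or two blocks *)

(** All but two elements are arbitrary; then [v] avoids a small bad set and [u] is forced by the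
    product. *)
Lemma set_prod1_exists (F : finFieldType) r : (3 <= r)%N -> (2 * r + 2 <= #|F|)%N ->
  exists U : {set F}, [/\ #|U| = r, 0 \notin U, 1 \notin U & \prod_(u in U) u = 1].
Proof.
move=> r3 rF; have [|W WU cW] := @subset_of_card F (~: [set 0; 1]) (r - 2).
  have := cardsC [set 0; 1 : F]; rewrite cards2 eq_sym oner_eq0 /=.
  move: #|_| #|_| rF => m1 m2 rF; lia.
have W01 w : w \in W -> w != 0 /\ w != 1.
  by move/(subsetP WU); rewrite !inE negb_or => /andP.
set P := \prod_(w in W) w.
have P0 : P != 0 by apply/prodf_neq0 => w /W01[].
pose Sq := [set v : F | P * v ^+ 2 == 1].
have cSq : (#|Sq| <= 2)%N.
  have [->|[v0 hv0]] := set_0Vmem Sq; first by rewrite cards0.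
  apply: (@leq_trans #|[set v0; - v0]|); last by rewrite cards2; case: eqP.
  apply/subset_leq_card/subsetP => v; move: hv0; rewrite !inE.
  move=> /eqP <- /eqP/(mulfI P0)/eqP.
  by rewrite eqf_sqr.
(* These values, at most [2r+1] in number, are excluded so that [v] is new and [u = (P * v)^-1]
   differs from [1], from [v] and from the elements of [W]. *)
pose bad := [set 0; 1; P^-1] :|: W :|: [set (P * w)^-1 | w in W] :|: Sq.
have [v vbad] : exists v, v \notin bad.
  have : (#|bad| < #|F|)%N.
    apply: leq_ltn_trans (leq_card_setU _ _) _.
    apply: (@leq_ltn_trans (3 + (r - 2) + (r - 2) + 2)%N); last by move: rF; lia.
    apply: leq_add cSq; apply: leq_trans (leq_card_setU _ _) _.
    rewrite -{2}cW; apply: leq_add (leq_imset_card _ _).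
    apply: leq_trans (leq_card_setU _ _) _; rewrite cW leq_add2r.
    apply: leq_trans (leq_card_setU _ _) _; rewrite cards1 cards2.
    by case: (_ != _).
  rewrite -(cardC bad) -[X in (X < _)%N]addn0 ltn_add2l => /card_gt0P[v].
  by rewrite inE => ?; exists v.
move: vbad; rewrite !inE !negb_or => /andP[/andP[/andP[/andP[/andP[v0 v1] vP] vW] vI] vS].
set u := (P * v)^-1.
have Pv0 : P * v != 0 by rewrite mulf_neq0.
have u1 : u != 1.
  by apply: contraNneq vP => /(congr1 GRing.inv); rewrite invrK invr1 => h;
     apply/eqP/(mulfI P0); rewrite h divff.
have uW : u \notin W.
  apply: contra vI => uW; apply/imsetP; exists u => //.
  by rewrite /u invfM invrK mulrA mulVf // mul1r.
have uv : u != v.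
  apply: contraNneq vS => uv; rewrite expr2 mulrA -{2}uv /u divff //.
have uvW : u \notin v |: W by rewrite !inE negb_or uv.
exists (u |: (v |: W)); split.
- by rewrite !cardsU1 uvW vW cW; lia.
- rewrite !inE !negb_or eq_sym invr_eq0 Pv0 eq_sym v0 /=.
  by apply/negP => /W01[]; rewrite eqxx.
- rewrite !inE !negb_or eq_sym u1 eq_sym v1 /=.
  by apply/negP => /W01[]; rewrite eqxx.
rewrite big_setU1 // big_setU1 //= -/P [v * P]mulrC /u mulVf //.
Qed.

(* The monic polynomial with root set [T] takes the same value at [0] and [1];
   for [u = t / (t - 1)] the condition reads [\prod u = 1]. *)
Lemma balanced_set_exists (F : finFieldType) r : (3 <= r)%N -> (2 * r + 2 <= #|F|)%N ->
  exists T : {set F}, [/\ #|T| = r, 0 \notin T, 1 \notin T &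
    \prod_(t in T) (0 - t) = \prod_(t in T) (1 - t)].
Proof.
move=> r3 rF; have [U [cU U0 U1 prodU]] := set_prod1_exists r3 rF.
have Un1 u : u \in U -> u - 1 != 0 by apply: contraTneq => /eqP; rewrite subr_eq0 => /eqP->.
have inj : {in U &, injective (fun u => u / (u - 1))}.
  move=> u v /Un1 u1 /Un1 v1 /eqP; rewrite eqr_div // => /eqP h.
  have : v - u = u * (v - 1) - v * (u - 1) by ring.
  by rewrite h subrr => /eqP; rewrite subr_eq0 eq_sym => /eqP.
exists [set u / (u - 1) | u in U]; split.
- by rewrite card_in_imset.
- apply/imsetP => -[u uU /esym/eqP]; rewrite mulf_eq0 invr_eq0 (negPf (Un1 u uU)) orbF.
  by apply/negP; apply: contraNneq U0 => <-.
- apply/imsetP => -[u uU /esym h]; have := divr1_eq h => /eqP.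
  by rewrite -subr_eq0 opprB addrC subrK oner_eq0.
(* For [t = u / (u - 1)] one has [0 - t = u * (1 - t)]. *)
rewrite !big_imset //= -[RHS]mul1r -[X in _ = X * _]prodU -big_split /=.
by apply: eq_bigr => u /Un1 u1; field.
Qed.

(** When [d <= r+1] the word fits in one block: [d] points of [A] carry a nonzero function with
    [d-1] vanishing moments, and the moment of exponent 0 is the check of [A]. *)
Lemma block_word_exists (F : finFieldType) (H : {set {set F}}) r d A :
  (forall e, e \in H -> #|e| = r.+1) -> A \in H -> (2 <= d <= r.+1)%N ->
  exists c, [/\ c \in sparse_code H (d - 2), c != 0 & (#|supp c| <= d)%N].
Proof.
move=> uH AH /andP[d2 dr]; have [|E EA cE] := @subset_of_card F A d; first by rewrite uH.
have [|L [LE L0 mom]] := @moments_exist F E (d - 2).+1; first by rewrite cE; lia.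
have := @sparse_code_word F H (d - 2) E L (fun=> A); rewrite subnK //.
apply=> //.
- by move=> x /(subsetP EA) xA.
move=> e eH; case: (A == e); last by rewrite big1 // => x /andP[].
have := mom 0%N isT; under eq_bigr => x _ do rewrite expr0 mulr1.
rewrite (bigID (mem E)) /= [X in _ + X]big1 ?addr0 => [sumE|x /LE //].
apply: etrans sumE.
by apply: eq_bigl => x; rewrite andbT.
Qed.

(** When [d = r+2] the word needs two blocks. Some nonzero [L] on [{0, 1}] and [T] has [r+1]
    vanishing moments. Testing it against the monic polynomial with root set [T], which has equal
    nonzero values at 0 and 1, gives [L 0 + L 1 = 0]. So [L] sums to zero on [{0, 1}] and on [T],
    which are placed in different edges. *)
Lemma balanced_blocks_exist (F : finFieldType) r : (3 <= r)%N -> (2 * r + 2 <= #|F|)%N ->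
  exists A B : {set F}, [/\ #|A| = r.+1, #|B| = r.+1, [disjoint A & B] &
    forall H : {set {set F}}, (forall e, e \in H -> #|e| = r.+1) -> A \in H -> B \in H ->
      exists c, [/\ c \in sparse_code H r, c != 0 & (#|supp c| <= r + 2)%N]].
Proof.
move=> r3 rF; have [T [cT T0 T1 fT]] := balanced_set_exists r3 rF.
have zo : (0 : F) != 1 by rewrite eq_sym oner_eq0.
have cZ : #|[set 0; 1 : F]| = 2 by rewrite cards2 zo.
have djZ : [disjoint [set 0; 1] & T].
  by rewrite disjoints_subset subUset !sub1set !inE T0 T1.
pose D := [set 0; 1] :|: T.
have cD : #|D| = (r + 2)%N by rewrite cardsU disjoint_setI0 // cards0 subn0 cZ cT addnC.
have [|E ED cE] := @subset_of_card F (~: D) r.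
  by have := cardsC D; rewrite cD; move: rF; move: #|_| #|_| => m1 m2; lia.
have [b bE] : exists b, b \in E by apply/card_gt0P; rewrite cE; lia.
have ED' x : x \in E -> [/\ x != 0, x != 1 & x \notin T].
  by move/(subsetP ED); rewrite !inE !negb_or => /andP[/andP[-> ->] ->].
(* Points of [E] fill [{0, 1}] and [T] up to disjoint sets of size [r+1]. *)
pose A := [set 0; 1] :|: (E :\ b); pose B := b |: T.
have [b0 b1 bT] := ED' b bE.
have djAB : [disjoint A & B].
  rewrite disjoints_subset; apply/subsetP => x; rewrite !inE negb_or.
  case/orP => [/orP[/eqP->|/eqP->]|/andP[-> /ED'[]]] //.
    by rewrite eq_sym b0.
  by rewrite eq_sym b1.
exists A, B; split=> //.
- rewrite cardsU disjoint_setI0; last first.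
    rewrite disjoints_subset subUset !sub1set !inE !negb_and.
    by apply/andP; split; apply/orP; right; apply/negP => /ED'[]; rewrite eqxx.
  by rewrite cards0 subn0 cZ; have := cardsD1 b E; rewrite bE cE; move: #|_| => m; lia.
- by rewrite cardsU1 bT cT.
move=> H uH AH BH; have [|L [LD L0 mom]] := @moments_exist F D r.+1.
  by rewrite cD addn2.
pose f := \prod_(x <- enum T) ('X - x%:P).
have fE x : f.[x] = \prod_(t in T) (x - t).
  rewrite horner_prod big_enum /=; apply: eq_bigr => t _.
  by rewrite hornerXsubC.
have f0 : f.[0] != 0.
  by rewrite fE; apply/prodf_neq0 => t tT;
     rewrite sub0r oppr_eq0; apply: contraNneq T0 => <-.
have L01 : L 0 + L 1 = 0.
  have sf : (size f <= r.+1)%N by rewrite size_prod_XsubC -cardE cT.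
  have := moments_horner mom sf; rewrite (bigD1 0) //= (bigD1 1) ?oner_eq0 //=.
  rewrite big1 ?addr0 => [|x /andP[x0 x1]].
    rewrite [f.[1]]fE -fT -fE -mulrDl => /eqP.
    by rewrite mulf_eq0 (negPf f0) orbF => /eqP.
  have [xT|xT] := boolP (x \in T); last by rewrite LD ?mul0r // !inE !negb_or x0 x1.
  by rewrite fE (bigD1 x) //= subrr mul0r mulr0.
have sumZ : \sum_(x in [set 0; 1]) L x = 0.
  by rewrite big_setU1 ?inE //= big_set1.
have sumT : \sum_(x in T) L x = 0.
  have := mom 0%N isT; under eq_bigr => x _ do rewrite expr0 mulr1.
  rewrite (bigID (mem D)) /= [X in _ + X]big1 ?addr0 => [|x /LD //].
  rewrite (eq_bigl [predU [set 0; 1] & T]) => [|x]; last by rewrite !inE.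
  by rewrite bigU //= sumZ add0r.
apply: (@sparse_code_word F H r D L (fun x : F => if x \in T then B else A)) => //.
  move=> x.
  rewrite !inE => xD; case: ifP => xT; first by rewrite !inE xT orbT.
  by rewrite !inE; move: xD; rewrite xT orbF => ->.
move=> e eH.
have AB : A != B.
  have A0 : 0 \in A by rewrite !inE eqxx.
  by apply/eqP => AB; have := disjointFr djAB A0; rewrite -AB A0.
have [->|eB] := eqVneq e B.
  rewrite -[RHS]sumT; apply: eq_bigl => x; rewrite !inE.
  by case: (x \in T); rewrite ?eqxx ?orbT ?orbF // (negPf AB) andbF.
have [->|eA] := eqVneq e A.
  rewrite -[RHS]sumZ; apply: eq_bigl => x; rewrite !inE.
  have := @disjointFl _ _ _ x djZ; rewrite !inE; case: (x \in T) => [->//|_].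
    by rewrite eq_sym (negPf AB) andbF.
  by rewrite orbF eqxx andbT.
rewrite big1 // => x /andP[_]; case: ifP => _ /eqP h.
  by rewrite h eqxx in eB.
by rewrite h eqxx in eA.
Qed.

(** * Choice of the degree and the resulting length *)

(** Since [1 + D * r.+1 <= D * (r + 2)] for [D >= 1], a field of size at least
    [block_const g r * D ^ g] is large enough for the greedy construction with degree [D]. *)
Definition block_const g r : nat := (2 * (r.+1 * (r + 2) ^ g))%N.

Lemma long_optimal_code (F : finFieldType) r d D :
  (5 <= d <= r + 2)%N -> (0 < D)%N ->
  (block_const ((d - 3) %/ 2) r * D ^ ((d - 3) %/ 2) <= #|F|)%N ->
  exists (n : nat) (C : code F n),
    [/\ (r.+1 %| n)%N, (D * #|F| <= 2 * n)%N & optimal_LRC C r d].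
Proof.
move=> /andP[d5 dr]; set g := ((d - 3) %/ 2)%N => D0 MF.
have g0 : (0 < g)%N by rewrite /g; lia.
have dg : (d <= 2 * g + 4)%N by rewrite /g; lia.
have r0 : (0 < r)%N by lia.
have large : (2 * (r.+1 * (1 + D * r.+1) ^ g) <= #|F|)%N.
  apply: leq_trans MF; rewrite /block_const -!mulnA leq_mul2l -expnMn /=.
  by rewrite leq_mul2l /= leq_exp2r //; nia.
have rF : (2 * r + 2 <= #|F|)%N.
  apply: leq_trans large; have : (0 < (1 + D * r.+1) ^ g)%N by rewrite expn_gt0.
  by move: (_ ^ g)%N => m; nia.
have F0 : (0 < #|F|)%N by lia.
have code (H : {set {set F}}) : sparse_hypergraph g r D H ->
    (D * #|F| <= 2 * (#|H| * r.+1))%N ->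
    (d - 2 < r * #|H|)%N ->
    (exists c, [/\ c \in sparse_code H (d - 2), c != 0 & (#|supp c| <= d)%N]) ->
    exists (n : nat) (C : code F n),
      [/\ (r.+1 %| n)%N, (D * #|F| <= 2 * n)%N & optimal_LRC C r d].
  move=> sH DH dH word; have nE := card_incidences (sparse_uniform sH).
  exists #|incidences H|, (sparse_code H (d - 2)); split.
  - by rewrite nE dvdn_mull.
  - by rewrite nE.
  by apply: sparse_code_optimal sH _ _ dH word; lia.
have [d1|d1] := leqP d r.+1.
  have [|H [_ sH DH]] := sparse_hypergraph_exists (V := F) (H0 := set0) g0 r0 _ large.
    by apply: sparse_disjoint => // e; rewrite inE.
  have H0 : (0 < #|H|)%N.
    rewrite lt0n; apply: contraTneq DH => ->.
    by rewrite mul0n muln0 -ltnNge muln_gt0 D0 F0.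
  have [A AH] := card_gt0P H0.
  apply: (code _ sH DH); first by nia.
  by apply: block_word_exists (sparse_uniform sH) AH _; lia.
have dE : d = (r + 2)%N by lia.
have r3 : (3 <= r)%N by lia.
have [A [B [cA cB djAB word]]] := balanced_blocks_exist r3 rF.
have AB : A != B.
  by apply: contraTneq djAB => ->; rewrite -setI_eq0 setIid -card_gt0 cB.
have [|H [HH sH DH]] := sparse_hypergraph_exists (V := F) (H0 := [set A; B]) g0 r0 _ large.
  apply: sparse_disjoint => // [e|e f]; rewrite !inE.
    by case/orP => /eqP->.
  case/orP => /eqP-> /orP[]/eqP->; rewrite ?eqxx // => _.
  by rewrite disjoint_sym.
(* As [d - 2 = r], a single edge would give dimension 0; the two starting edges make it positive. *)
have cH : (2 <= #|H|)%N by apply: leq_trans (subset_leq_card HH); rewrite cards2 AB.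
have d2 : (d - 2 = r)%N by lia.
apply: (code _ sH DH); first by nia.
rewrite d2 dE; apply: word; first exact: sparse_uniform sH.
  by apply: (subsetP HH); rewrite !inE eqxx.
by apply: (subsetP HH); rewrite !inE eqxx orbT.
Qed.

(** One factor 2 comes from [n >= D q / 2], the other from [D + 1 <= 2 D] when the degree is rounded
    down. *)
Definition length_const (R : realType) (d r : nat) : R :=
  (4 * (block_const ((d - 3) %/ 2) r)%:R)^-1.

Lemma block_const_gt0 g r : (0 < block_const g r)%N.
Proof. by rewrite /block_const !muln_gt0 expn_gt0 addn2. Qed.

Lemma length_const_gt0 (R : realType) d r : 0 < length_const R d r.
Proof. by rewrite invr_gt0 mulr_gt0 // ltr0n block_const_gt0. Qed.

Lemma power_length_optimal_code (R : realType) r d : (5 <= d <= r + 2)%N ->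
  exists q0 : nat, forall F : finFieldType, (q0 <= #|F|)%N ->
    exists (n : nat) (C : code F n),
      [/\ (r.+1 %| n)%N,
        length_const R d r * #|F|%:R `^ (1 + 1 / ((d - 3) %/ 2)%:R) <= n%:R &
        optimal_LRC C r d].
Proof.
move=> dr; rewrite /length_const; set g := ((d - 3) %/ 2)%N; set M := block_const g r.
have g0 : (0 < g)%N by rewrite /g; lia.
exists M => F MF; set q := #|F|.
have M0 : (0 < M)%N := block_const_gt0 g r.
have q0 : (0 < q)%N by apply: leq_trans MF.
(* [D] is the largest degree that the size of the field allows. *)
have [D D0 /andP[DM Dmax]] : exists2 D, (0 < D)%N & (M * D ^ g <= q < M * D.+1 ^ g)%N.
  have ex : exists D, (M * D ^ g <= q)%N by exists 1%N; rewrite exp1n muln1.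
  have bnd D : (M * D ^ g <= q)%N -> (D <= q)%N.
    apply: leq_trans; case: D => // D.
    apply: (@leq_trans (D.+1 ^ g)); last exact: leq_pmull.
    by rewrite -{1}[D.+1]expn1 leq_pexp2l.
  case: (ex_maxnP ex bnd) => D hD maxD; exists D.
    by apply: maxD; rewrite exp1n muln1.
  by rewrite hD ltnNge; apply/negP => /maxD; rewrite ltnn.
have [n [C [rn Dn opt]]] := long_optimal_code dr D0 DM.
exists n, C; split=> //.
(* By maximality [q < M (D+1)^g <= (2 M D)^g], using [M <= M^g]. *)
have root : q%:R `^ (1 / g%:R) <= (2 * M * D)%:R :> R.
  have -> : (2 * M * D)%:R = (((2 * M * D) ^ g)%:R : R) `^ (1 / g%:R).
    rewrite natrX -powR_mulrn ?ler0n // -powRrM mul1r divff ?powRr1 ?ler0n //.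
    by rewrite pnatr_eq0 -lt0n.
  apply: ge0_ler_powR; rewrite ?nnegrE ?ler0n ?divr_ge0 // ler_nat.
  apply: leq_trans (ltnW Dmax) _; rewrite [(2 * M)%N]mulnC -mulnA expnMn.
  apply: leq_mul; first by rewrite -{1}[M]expn1 leq_pexp2l.
  by rewrite leq_exp2r //; lia.
rewrite powRD; last by rewrite pnatr_eq0 -lt0n q0 implybT.
rewrite powRr1 ?ler0n // ler_pdivrMl; last by rewrite mulr_gt0 // ltr0n.
apply: (@le_trans _ _ (q%:R * (2 * M * D)%:R)); first by rewrite ler_wpM2l.
by rewrite -!natrM ler_nat; have := leq_mul (leqnn M) Dn; rewrite -/q; lia.
Qed.

(** * The upper bound for distance 5 *)

(** Inclusion of left kernels means inclusion of column spaces the other way; after transposition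
    this is tested on the cokernel. *)
Lemma ker_sub_factor (F : fieldType) m n p (A : 'M[F]_(m, n)) (B : 'M[F]_(m, p)) :
  (forall x : 'rV_m, x *m A = 0 -> x *m B = 0) -> exists D, B = A *m D.
Proof.
move=> hAB; have : (B^T <= A^T)%MS.
  rewrite submxE; apply/eqP/trmx_inj; rewrite trmx_mul trmxK trmx0.
  apply/row_matrixP => i; rewrite row_mul row0; apply: hAB.
  rewrite -row_mul -[A]trmxK -trmx_mul.
  by rewrite trmxK mulmx_coker trmx0 row0.
case/submxP => D BD; exists D^T.
by rewrite -[LHS]trmxK BD trmx_mul trmxK.
Qed.

Definition pairing (F : finFieldType) n (h c : 'rV[F]_n) : F :=
  \sum_i h ord0 i * c ord0 i.

(** By linearity, coordinate [i] of a codeword is a linear function of its coordinates in [R :\ i];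
    the coefficients of that function give the check [h]. *)
Lemma recovery_check (F : finFieldType) n (C : code F n) i R : recovery_set C i R ->
  exists h : 'rV[F]_n, [/\ i \in supp h, supp h \subset R &
    forall c, c \in C -> pairing h c = 0].
Proof.
move=> [iR recov].
(* Otherwise [c] and [0] have the same projection but different values at [i]. *)
have det c : c \in C -> (forall j, j \in R :\ i -> c ord0 j = 0) -> c ord0 i = 0.
  move=> cC c0; apply/eqP; apply: contraT => ci.
  have /setP/(_ 0) := recov _ _ ci; rewrite in_set0 => /negP; case; rewrite inE.
  apply/andP; split; apply/imsetP.
    exists c; first by rewrite inE cC /=.
    by apply/rowP => j; rewrite !mxE c0 ?enum_valP.
  by exists 0; [rewrite inE mem0v mxE /=|apply/rowP => j; rewrite !mxE].
pose G : 'M[F]_(\dim C, n) := \matrix_(k, j) (vbasis C)`_k ord0 j.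
have GC (x : 'rV_(\dim C)) : x *m G \in C.
  rewrite (_ : x *m G = \sum_k x ord0 k *: (vbasis C)`_k).
    by apply: memv_suml => k _; rewrite memvZ // vbasis_mem // mem_nth // size_tuple.
  by apply/rowP => j; rewrite !mxE summxE; apply: eq_bigr => k _; rewrite !mxE.
pose S := R :\ i.
(* Columns outside [S] are zeroed rather than deleted, so that [D] is indexed by all coordinates. *)
pose GS : 'M[F]_(\dim C, n) := \matrix_(k, j) if j \in S then G k j else 0.
have [|D hD] := @ker_sub_factor F _ _ _ GS (col i G).
  move=> x hx; apply/rowP => z; rewrite !ord1.
  have xi : (x *m G) ord0 i = 0.
    apply: det (GC x) _ => j jS.
    have := congr1 (fun w : 'rV_n => w ord0 j) hx; rewrite !mxE => hj; apply: etrans hj.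
    by apply: eq_bigr => k _; rewrite !mxE jS.
  rewrite [RHS]mxE -[RHS]xi !mxE.
  by apply: eq_bigr => k _; rewrite !mxE.
pose h : 'rV[F]_n := \row_j ((j == i)%:R - if j \in S then D j ord0 else 0).
exists h; split.
- by rewrite inE mxE eqxx !inE eqxx /= subr0 oner_eq0.
- apply/subsetP => j; rewrite inE mxE; apply: contraR => jR.
  have /negPf-> : j != i by apply: contraNneq jR => ->.
  by rewrite !inE (negPf jR) andbF subr0.
move=> c cC; rewrite /pairing.
under eq_bigr => j _ do rewrite mxE mulrBl.
rewrite sumrB (bigD1 i) //= eqxx mul1r big1 ?addr0 => [|j /negPf->]; last first.
  by rewrite mul0r.
pose x := \row_k coord (vbasis C) k c.
have cE : c = x *m G.
  apply/rowP => j; rewrite [in LHS](coord_vbasis cC) summxE mxE.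
  by apply: eq_bigr => k _; rewrite !mxE.
apply/eqP; rewrite subr_eq0; apply/eqP.
have -> : c ord0 i = (x *m col i G) ord0 ord0.
  by rewrite [in LHS]cE !mxE; apply: eq_bigr => k _; rewrite !mxE.
rewrite hD mulmxA mxE; apply: eq_bigr => j _.
case: ifP => jS; last first.
  by rewrite mul0r mxE big1 ?mul0r // => k _; rewrite !mxE jS mulr0.
rewrite mulrC; congr (_ * _); rewrite cE !mxE; apply: eq_bigr => k _.
by rewrite [GS k j]mxE jS.
Qed.

(** A finite set rather than a subspace, since dimensions are compared by counting elements. *)
Definition local_space (F : finFieldType) n (h : 'I_n -> 'rV[F]_n) (J : {set 'I_n}) :
  {set 'rV[F]_n} :=
  [set v | [forall j in J, pairing (h j) v == 0]].

(** * Private coordinates of a family of checks *)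

Section Private.
Variables (F : finFieldType) (n : nat) (h : 'I_n -> 'rV[F]_n) (J : {set 'I_n}).

Definition private j : {set 'I_n} :=
  [set i in supp (h j) | [forall j' in J, (j' != j) ==> (i \notin supp (h j'))]].

Lemma privateP j i : reflect (i \in supp (h j) /\
  forall j', j' \in J -> j' != j -> h j' ord0 i = 0) (i \in private j).
Proof.
rewrite [X in reflect _ X]in_set; apply: (iffP andP) => -[hi priv]; split=> //.
  move=> j' j'J j'j; have := forall_inP priv j' j'J; rewrite j'j /=.
  by rewrite inE negbK => /eqP.
by apply/forall_inP => j' j'J; apply/implyP => j'j; rewrite inE negbK priv.
Qed.

Lemma pairingB (c v w : 'rV[F]_n) : pairing c (v - w) = pairing c v - pairing c w :> F.
Proof. by rewrite /pairing -sumrB; apply: eq_bigr => i _; rewrite !mxE mulrBr. Qed.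

Lemma pairingZD (c : 'rV[F]_n) a v w :
  pairing c (a *: v + w) = a * pairing c v + pairing c w :> F.
Proof.
rewrite /pairing mulr_sumr -big_split; apply: eq_bigr => i _.
by rewrite !mxE mulrDr mulrCA.
Qed.

Hypothesis priv0 : forall j, j \in J -> private j != set0.

(** Independence of the checks in counting form: pick one private coordinate per check; the other
    coordinates of a vector determine it, because each check then involves only one unknown. *)
Lemma card_local_space : (#|local_space h J| * #|F| ^ #|J| <= #|F| ^ n)%N.
Proof.
have [p hp] : exists p : 'I_n -> 'I_n, forall j, j \in J -> p j \in private j.
  apply: (@fin_all_exists _ (fun=> 'I_n) (fun j i => j \in J -> i \in private j)).
  move=> j; have [/priv0/set0Pn[i ?]|_] := boolP (j \in J).
    by exists i.
  by exists j.
pose Q := [set p j | j in J].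
have cQ : #|Q| = #|J|.
  apply: card_in_imset => j j' jJ j'J pjj'; apply/eqP; apply: contraT => jj'.
  have /privateP[_ /(_ j jJ jj') h0] := hp j' j'J; have /privateP[] := hp j jJ.
  by rewrite pjj' inE h0 eqxx.
have VQ : (#|local_space h J| <= #|F| ^ #|~: Q|)%N.
  rewrite -[X in (_ <= _ ^ X)%N]mul1n -card_mx.
  apply: (@leq_card_in _ _ (proj (~: Q))) => u v.
  rewrite !inE => /forall_inP uV /forall_inP vV /rowP uv.
  have out i : i \notin Q -> u ord0 i = v ord0 i.
    move=> iQ; have iQ' : i \in ~: Q by rewrite inE.
    by have := uv (enum_rank_in iQ' i); rewrite !mxE enum_rankK_in.
  apply/rowP => i; have [|/out//] := boolP (i \in Q).
  case/imsetP => j jJ ->; have := pairingB (h j) u v.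
  rewrite (eqP (uV j jJ)) (eqP (vV j jJ)) subrr.
  have /privateP[+ _] := hp j jJ; rewrite inE => hj0.
  rewrite /pairing (bigD1 (p j)) //= big1 ?addr0 => [/eqP|k kj].
    by rewrite mulf_eq0 (negPf hj0) /= !mxE subr_eq0 => /eqP.
  have [kQ|/out uvk] := boolP (k \in Q); last by rewrite !mxE uvk subrr mulr0.
  case/imsetP: kQ kj => j' j'J -> jj'.
  have /privateP[_ -> //] := hp j' j'J; first by rewrite mul0r.
  by apply: contraNneq jj' => ->.
have := cardsC Q; rewrite cQ card_ord => nE.
by rewrite -[X in (_ <= _ ^ X)%N]nE addnC expnD leq_mul2r VQ orbT.
Qed.

(* Each private pair yields a vector of weight at most 2 satisfying all local
   checks; the cosets of [C] through the nonzero multiples of these vectors are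
   pairwise distinct, as the minimum distance exceeds 4. *)
Lemma card_private_pairs (C : code F n) :
  (forall c, c \in C -> c != 0 -> (5 <= #|supp c|)%N) ->
  (forall j c, c \in C -> pairing (h j) c = 0) ->
  (#|[set j in J | (1 < #|private j|)%N]| * (#|F| - 1) * #|F| ^ \dim C * #|F| ^ #|J|
    <= #|F| ^ n)%N.
Proof.
move=> dC hC; set Gd := [set j in J | _].
have [v hv] : exists v : 'I_n -> 'rV[F]_n, forall j, j \in Gd ->
    [/\ v j \in local_space h J, v j != 0, supp (v j) \subset private j &
        (#|supp (v j)| <= 2)%N].
  apply: (@fin_all_exists _ (fun=> 'rV[F]_n) (fun j v => j \in Gd ->
    [/\ v \in local_space h J, v != 0, supp v \subset private j & (#|supp v| <= 2)%N])) => j.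
  case: (boolP (j \in Gd)) => [|_]; last by exists 0.
  rewrite inE => /andP[jJ /card_gt1P[a [b [aj bj ab]]]].
  have [/privateP[ha pa] /privateP[hb pb]] := (aj, bj).
  rewrite !inE in ha hb.
  (* Orthogonal to [h j] by the exchange of its two values, and to the other checks because [a] and
     [b] are private to [j]. *)
  pose u : 'rV[F]_n := \row_i ((i == a)%:R * h j ord0 b - (i == b)%:R * h j ord0 a).
  have pu k : pairing (h k) u = h k ord0 a * h j ord0 b - h k ord0 b * h j ord0 a.
    rewrite /pairing; under eq_bigr => i _ do rewrite mxE mulrBr.
    rewrite sumrB; congr (_ - _).
      rewrite (bigD1 a) //= eqxx mul1r big1 ?addr0 // => i /negPf->.
      by rewrite mul0r mulr0.
    rewrite (bigD1 b) //= eqxx mul1r big1 ?addr0 // => i /negPf->.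
    by rewrite mul0r mulr0.
  have sab : supp u \subset [set a; b].
    apply/subsetP => i; rewrite !inE mxE; apply: contraR; rewrite negb_or.
    by move=> /andP[/negPf-> /negPf->]; rewrite !mul0r subrr.
  exists u => _; split.
  - rewrite inE; apply/forall_inP => k kJ; rewrite pu.
    have [->|kj] := eqVneq k j; first by rewrite mulrC subrr.
    by rewrite (pa k) // (pb k) // !mul0r subrr.
  - apply/eqP => /rowP/(_ a); rewrite !mxE eqxx mul1r (negPf ab) mul0r subr0.
    by move/eqP; apply/negP.
  - by apply: subset_trans sab _; rewrite subUset !sub1set aj.
  by apply: leq_trans (subset_leq_card sab) _; rewrite cards2; case: (_ != _).
have F1 : #|[set~ (0 : F)]| = (#|F| - 1)%N by rewrite cardsC1 subn1.
have cC : #|[set c | c \in C]| = (#|F| ^ \dim C)%N.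
  by rewrite cardsE (card_vspace C).
(* It remains to map the triples [(j, a, c)], with [a] nonzero, injectively into the local space. *)
apply: leq_trans card_local_space; rewrite leq_mul2r; apply/orP; right.
rewrite -F1 -cC -!cardsX.
pose f (x : 'I_n * F * 'rV[F]_n) := x.1.2 *: v x.1.1 + x.2.
rewrite -(card_in_imset (f := f)).
  apply/subset_leq_card/subsetP => w /imsetP[[[j a] c] + ->] /=.
  rewrite !inE /= => /andP[/andP[/andP[jJ jp] a0] cC0].
  have [|+ _ _ _] := hv j; first by rewrite inE jJ.
  rewrite inE => /forall_inP vj; apply/forall_inP => k kJ.
  by rewrite pairingZD (eqP (vj k kJ)) mulr0 add0r hC.
move=> [[j a] c] [[j' b] c'].
rewrite !in_setX !inE /= => /andP[/andP[jG a0] cC0] /andP[/andP[j'G b0] cC0'] fE.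
have jG' : j \in Gd by rewrite inE.
have j'G' : j' \in Gd by rewrite inE.
have [_ vj0 vjs vj2] := hv j jG'; have [_ vj0' vjs' vj2'] := hv j' j'G'.
have uE : a *: v j - b *: v j' = c' - c.
  rewrite /f /= in fE; apply: (addIr c).
  by rewrite subrK addrAC fE [b *: _ + _]addrC addrK.
(* This difference is a codeword of weight at most 4. *)
have u0 : a *: v j - b *: v j' = 0.
  apply/eqP; apply: contraT => u0; have := dC _ _ u0; rewrite {1}uE memvB // => /(_ isT).
  rewrite leqNgt ltnS => /negP; case.
  apply: (@leq_trans #|supp (v j) :|: supp (v j')|).
    apply/subset_leq_card/subsetP => i; rewrite !inE !mxE; apply: contraR.
    by rewrite negb_or !negbK => /andP[/eqP-> /eqP->]; rewrite !mulr0 subrr.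
  by apply: leq_trans (leq_card_setU _ _) (leq_add vj2 vj2').
have cc' : c = c' by apply/esym/eqP; rewrite -subr_eq0 -uE u0.
have jj' : j = j'.
  apply/eqP; apply: contraT => jj'.
  have [i vi] : exists i, i \in supp (v j).
    apply/set0Pn; apply: contra vj0 => /eqP/setP s0; apply/eqP/rowP => i.
    by have := s0 i; rewrite !inE mxE => /negbFE/eqP.
  have /privateP[hi _] := subsetP vjs i vi.
  have vi' : v j' ord0 i = 0.
    apply/eqP; apply: contraT => vi'.
    have is' : i \in supp (v j') by rewrite inE.
    have /privateP[_ h0] := subsetP vjs' i is'.
    by move: hi; rewrite inE h0 ?eqxx //; move: jG => /andP[].
  have := congr1 (fun w : 'rV_n => w ord0 i) u0; rewrite !mxE vi' mulr0 subr0 => /eqP.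
  by rewrite mulf_eq0 (negPf a0) /=; move: vi; rewrite inE => /negPf->.
rewrite -cc' -jj'; congr (_, _, _); apply/eqP; rewrite -subr_eq0.
move: u0; rewrite -jj' -scalerBl => /eqP; rewrite scaler_eq0.
by rewrite (negPf vj0) orbF.
Qed.
End Private.

(** Dropping [j] from an inclusion-minimal cover uncovers some coordinate, which is therefore
    private to [j]. *)
Lemma minimal_cover (F : finFieldType) n (h : 'I_n -> 'rV[F]_n) :
  (forall i, i \in supp (h i)) ->
  exists J : {set 'I_n}, (forall i, exists2 j, j \in J & i \in supp (h j)) /\
    forall j, j \in J -> private h J j != set0.
Proof.
move=> hii; pose P (J : {set 'I_n}) := [forall i, exists j in J, i \in supp (h j)].
have [|J /minsetP[cov min]] := @ex_minset _ P.
  by exists setT; apply/forallP => i;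
     apply/exists_inP; exists i; [rewrite inE|exact: hii].
exists J; split=> [i|j jJ]; first by have /exists_inP := forallP cov i.
apply/set0Pn/existsP; apply: contraT => /existsPn priv.
have : j \in J :\ j.
  rewrite (min (J :\ j)) ?subD1set //; apply/forallP => i; apply/exists_inP.
  have /exists_inP[j' j'J hj'] := forallP cov i.
  have [j'j|j'j] := eqVneq j' j; last by exists j' => //; rewrite !inE j'j.
  apply/exists_inP; apply: contraR (priv i) => /exists_inPn none; apply/privateP.
  rewrite -{1}j'j; split=> // k kJ kj; apply/eqP.
  by have := none k; rewrite !inE kj kJ negbK; apply.
by rewrite !inE eqxx.
Qed.

(** Double counting: a coordinate lies in two supports or is private to one check, so it counts at
    least twice in the sum of [#|supp| + #|private|]. A check with at most one private coordinate
    contributes at most [r+2], any other at most [2 (r+1) = (r+2) + r]. *)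
Lemma private_count (F : finFieldType) n (h : 'I_n -> 'rV[F]_n) (J : {set 'I_n}) r :
  (forall i, exists2 j, j \in J & i \in supp (h j)) ->
  (forall j, #|supp (h j)| <= r.+1)%N ->
  (2 * n <= #|J| * r.+2 + r * #|[set j in J | 1 < #|private h J j|]|)%N.
Proof.
move=> cov hr; set G := [set j in J | _].
have mem_sum (A : 'I_n -> {set 'I_n}) :
    (\sum_(j in J) #|A j| = \sum_i \sum_(j in J) (i \in A j))%N.
  rewrite exchange_big /=; apply: eq_bigr => j _.
  by rewrite -sum1_card big_mkcond; apply: eq_bigr => i _; case: (i \in A j).
have two : (2 * n <= \sum_(j in J) (#|supp (h j)| + #|private h J j|))%N.
  rewrite big_split /= !mem_sum -big_split /= mulnC -{1}[n]card_ord -sum_nat_const.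
  apply: leq_sum => i _; have [j jJ ij] := cov i.
  rewrite (bigD1 j) //= ij; have [ip|ip] := boolP (i \in private h J j).
    by rewrite [X in (_ <= _ + X)%N](bigD1 j) //= ip; lia.
  have [k kJ [kj ik]] : exists2 k, k \in J & k != j /\ i \in supp (h k).
    move: ip; rewrite in_set ij /= => /forall_inPn[k kJ].
    by rewrite negb_imply negbK => /andP[kj ik]; exists k.
  by rewrite (bigD1 k) ?kJ //= ik; lia.
apply: leq_trans two _.
apply: (@leq_trans (\sum_(j in J) (r.+2 + r * (j \in G)))).
  apply: leq_sum => j jJ; rewrite [j \in G]inE jJ /=.
  have p1 := subset_leq_card (_ : private h J j \subset supp (h j)).
  have ps : (#|private h J j| <= #|supp (h j)|)%N.
    by apply: p1; apply/subsetP => i /privateP[].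
  by have := hr j; move: #|supp _| #|private _ _ _| ps => a b; case: ltnP; nia.
rewrite big_split /= sum_nat_const leq_add2l -big_distrr /= leq_mul2l.
rewrite -sum1_card [X in (_ <= X)%N]big_mkcond [X in (X <= _)%N]big_mkcond /=.
apply/orP; right; apply: leq_sum => j _; case: (j \in G); by case: (j \in J).
Qed.

(** * Parameters and length of optimal codes of distance 5 *)

(** Inserting the value of [k] given by optimality into [(c - 1) r < k], with [c] the ceiling,
    yields [c <= N] when [5 <= r+1] and [c <= N - 1] when [5 = r+2]. The gain in the second case
    offsets the weaker optimal value. *)
Lemma optimal_redundancy (F : finFieldType) r N (C : code F (N * r.+1)) :
  (3 <= r)%N -> optimal_LRC C r 5 -> (N * r.+1 <= \dim C + N + 3)%N.
Proof.
move=> r3 [_ _ _ opt]; set k := \dim C in opt *.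
have r0 : 0 < r%:Q by rewrite ltr0n; lia.
have := ceil_itv (k%:Q / r%:Q); move: opt; rewrite /singleton_bound.
move: (Num.ceil _) => c opt /andP[+ _].
rewrite ltr_pdivlMr // -[r%:Q]pmulrn -[k%:Q]pmulrn => h.
have {}h : (c - 1) * r%:Z < k%:Z.
  by rewrite -(ltr_int rat) intrM.
case: opt => [[r4 opt]|[r5 _ opt]].
  have cN : c <= N%:Z by nia.
  lia.
have cN : c <= N%:Z - 1 by nia.
lia.
Qed.

Lemma optimal_length_bound (F : finFieldType) n (C : code F n) r :
  (3 <= r)%N -> (r.+1 %| n)%N -> optimal_LRC C r 5 ->
  (n <= 7 * r.+1 * #|F| ^ 2)%N.
Proof.
move=> r3 /dvdnP[N nE]; subst n => opt; have red := optimal_redundancy r3 opt.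
case: opt => _ loc [_ dist] _.
have wt c : c \in C -> c != 0 -> (5 <= #|supp c|)%N.
  move=> cC c0; have := dist c 0 cC (mem0v C) c0; rewrite /hamming_dist.
  by congr (_ <= _)%N; apply: eq_card => i; rewrite !inE !mxE.
have [h hh] : exists h : 'I_(N * r.+1) -> 'rV[F]_(N * r.+1), forall i,
    [/\ i \in supp (h i), (#|supp (h i)| <= r.+1)%N &
      forall c, c \in C -> pairing (h i) c = 0].
  apply: (@fin_all_exists _ (fun=> 'rV[F]_(N * r.+1)) (fun i h =>
    [/\ i \in supp h, (#|supp h| <= r.+1)%N & forall c, c \in C -> pairing h c = 0])) => i.
  have [R [rec cR]] := loc i; have [h [ih hR hC]] := recovery_check rec.
  by exists h; split=> //; have := subset_leq_card hR; rewrite cR.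
have [|J [cov priv0]] := @minimal_cover F _ h; first by move=> i; case: (hh i).
have cnt := @private_count F _ h J r cov (fun j => let: And3 _ hr _ := hh j in hr).
have := @card_private_pairs F _ h J priv0 C wt (fun j => let: And3 _ _ hC := hh j in hC).
have CV : (#|F| ^ (\dim C + #|J|) <= #|F| ^ (N * r.+1))%N.
  rewrite expnD; apply: leq_trans (card_local_space priv0); rewrite leq_mul2r.
  apply/orP; right; have <- : #|[set c | c \in C]| = (#|F| ^ \dim C)%N.
    by rewrite cardsE (card_vspace C).
  apply/subset_leq_card/subsetP => c; rewrite inE => cC; rewrite inE.
  by apply/forall_inP => j _; have [_ _ ->] := hh j.
have q1 : (1 < #|F|)%N by exact: finNzRing_gt1.
have dimJ : (\dim C + #|J| <= N * r.+1)%N by rewrite -(leq_exp2l _ _ q1).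
have GJ : (#|[set j in J | 1 < #|private h J j|]| <= #|J|)%N.
  by apply/subset_leq_card/subsetP => j; rewrite inE => /andP[].
move: GJ cnt dimJ red; move: #|[set j in J | _]| #|J| (\dim C) #|F| q1.
move=> G m k q q1 GJ cnt dimJ red.
have NJ : (N <= m)%N by nia.
(* [dimJ] and [red] give [m <= N + 3]; then [cnt] gives [N <= G + 3 + 6/r], and [r >= 3]. *)
have NG : (N <= G + 5)%N by nia.
rewrite -mulnA -expnD => pairs.
(* Since [N <= m], [red] bounds the exponent [N * r.+1] by [k + m + 3]. *)
have G3 : (G * (q - 1) <= q ^ 3)%N.
  have pos : (0 < q ^ (k + m))%N by rewrite expn_gt0; lia.
  rewrite -(leq_pmul2r pos) (leq_trans pairs) // -expnD leq_exp2l //; lia.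
have Gq : (G <= 2 * q ^ 2)%N.
  have pos : (0 < q - 1)%N by lia.
  rewrite -(leq_pmul2r pos) (leq_trans G3) //; rewrite expnS; nia.
(* Now [N <= 2 q^2 + 5 <= 7 q^2]. *)
have q2 : (0 < q ^ 2)%N by rewrite expn_gt0; lia.
nia.
Qed.

Theorem theorem1p2 (R : realType) :
  exists c : nat -> nat -> R,
    (forall r d : nat, (1 <= r)%N -> (5 <= d)%N -> (d <= r + 2)%N ->
      0 < c d r /\
      exists q0 : nat, forall F : finFieldType, (q0 <= #|F|)%N ->
        exists (n : nat) (C : code F n),
          [/\ (r.+1 %| n)%N,
              c d r * #|F|%:R `^ (1 + 1 / ((d - 3) %/ 2)%:R) <= n%:R &
              optimal_LRC C r d])
    /\
    (forall r : nat, (3 <= r)%N ->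
      (exists q0 : nat, forall F : finFieldType, (q0 <= #|F|)%N ->
        exists (n : nat) (C : code F n),
          [/\ (r.+1 %| n)%N,
              c 5%N r * #|F|%:R ^+ 2 <= n%:R &
              optimal_LRC C r 5])
      /\
      (exists C' : R, forall (F : finFieldType) (n : nat) (C : code F n),
        (r.+1 %| n)%N -> optimal_LRC C r 5 ->
        n%:R <= C' * #|F|%:R ^+ 2)).
Proof.
exists (length_const R); split=> [r d _ d5 dr|r r3].
  split; first exact: length_const_gt0.
  by apply: power_length_optimal_code; rewrite d5.
split.
  have [|q0 hq0] := @power_length_optimal_code R r 5; first by rewrite -ltnS addn2.
  exists q0 => F /hq0[n [C [rn len opt]]]; exists n, C; split=> //.
  (* For [d = 5] the floor is 1, so the exponent is [1 + 1/1 = 2]. *)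
  by move: len; rewrite divr1 -(natrD _ 1 1) powR_mulrn ?ler0n.
exists (7 * r.+1)%:R => F n C rn opt.
by rewrite -natrX -natrM ler_nat (optimal_length_bound r3 rn opt).
Qed.
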